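(* Let $n\ge 2$, let $k=k(t,n)$ be one of the digital adjacencies of $\mathbb{Z}^n$, and let $SC_k^{n,l}=(x_i)_{i\in\{0,\dots,l-1\}}$ be a simple closed $k$-curve with $l\ge 4$ elements in $\mathbb{Z}^n$, equipped with the operations $x_i\ast_1 x_j=x_{i+j\,(\mathrm{mod}\,l)}$ and $x_i\star x_j=x_{i\cdot j\,(\mathrm{mod}\,l)}$. Then $(SC_k^{n,l},\ast_1,\star)$ (with the $k$-adjacency) is not a $DT$-$k$-ring.
   Context: For $1\le t\le n$, two distinct points of $\mathbb{Z}^n$ are $k(t,n)$-adjacent if at most $t$ of their coordinates differ by $\pm1$ and all the other coordinates coincide; the adjacency is named by the number $k=k(t,n)=\sum_{i=1}^{t}2^i\binom{n}{i}$. A digital image $(X,k)$ is a set $X\subset\mathbb{Z}^n$ with such an adjacency; for $x\in X$, $N_k(x,1)=\{y\in X: y \text{ is } k\text{-adjacent to } x\}\cup\{x\}$. A map $f:(X,k)\to(Y,k')$ is $(k,k')$-continuous if $f(N_k(x,1))\subset N_{k'}(f(x),1)$ for all $x\in X$ ($k$-continuous if the two images lie in the same $\mathbb{Z}^n$ and $k=k'$). For $(X,k)$ with $k=k(t,n)$, put $k^\ast:=k(t,2n)$ (only a label). Distinct points $p=(x_1,x_2)$, $q$ of $X^2=X\times X$ are $G_{k^\ast}$-adjacent if $q\in (N_k(x_1,1)\times\{x_2\})\cup(\{x_1\}\times N_k(x_2,1))$; $N_{G_{k^\ast}}(p,1)$ is the set of points $G_{k^\ast}$-adjacent to $p$, together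 with $p$. A map $f:(X^2,G_{k^\ast})\to(X,k)$ is $(G_{k^\ast},k)$-continuous if $f(N_{G_{k^\ast}}(p,1))\subset N_k(f(p),1)$ for all $p\in X^2$. A $DT$-$k$-group $(X,k,\ast_1)$ is a digital image $(X,k)$ with a group structure $(X,\ast_1)$ such that $(x,y)\mapsto x\ast_1 y$ is $(G_{k^\ast},k)$-continuous and the inverse map $x\mapsto x^{-1}$ of $\ast_1$ is $k$-continuous; it is abelian if $(X,\ast_1)$ is. A $DT$-$k$-ring $(X,k,\ast_1,\star)$ is an abelian $DT$-$k$-group $(X,k,\ast_1)$ together with a ring structure $(X,\ast_1,\star)$ such that $(x,y)\mapsto x\star y$ is also $(G_{k^\ast},k)$-continuous from $(X^2,G_{k^\ast})$ to $(X,k)$. A simple closed $k$-curve with $l$ elements in $\mathbb{Z}^n$ ($l\ge 4$, $n\ge 2$), denoted $SC_k^{n,l}$, is a sequence $(x_i)_{i\in\{0,\dots,l-1\}}$ of $l$ distinct points of $\mathbb{Z}^n$ such that $x_i$ and $x_j$ are $k$-adjacent if and only if $i-j\equiv\pm1\pmod l$. Indices mod $l$ are reduced to $\{0,\dots,l-1\}$. *)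

(* Defs.v *)
From mathcomp Require Import all_boot all_order all_algebra.
From mathcomp Require Import boolp classical_sets.

Set Implicit Arguments.
Unset Strict Implicit.
Unset Printing Implicit Defensive.

Local Open Scope classical_set_scope.

(* A point of Z^n is a row vector, and a digital image is a set X of points
   together with the parameter t of its adjacency. The numbers
   k(t, n) = \sum_(1 <= i < t.+1) 2 ^ i * 'C(n, i) and k^* = k(t, 2n) are only
   names for adjacencies, so everything below is indexed by t itself. *)
Notation point n := 'rV[int]_n.

Definition differ_by_one n (p q : point n) (i : 'I_n) : bool :=
  (`|p ord0 i - q ord0 i| == 1)%R.

Definition adjacent n (t : nat) (p q : point n) : bool :=
  [&& p != q,
      #|[set i | differ_by_one p q i]%SET| <= t
    & [forall i, differ_by_one p q i || (p ord0 i == q ord0 i)]].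

(* N_k(x, 1), computed inside the image X *)
Definition nbhd1 n t (X : set (point n)) (x : X) : set X :=
  [set y | adjacent t (val y) (val x)] `|` [set x].

Definition G_adjacent n t (X : set (point n)) (p q : X * X) : Prop :=
  q <> p /\
  ((nbhd1 t p.1 `*` [set p.2]) `|` ([set p.1] `*` nbhd1 t p.2)) q.

Definition G_nbhd1 n t (X : set (point n)) (p : X * X) : set (X * X) :=
  [set q | G_adjacent t p q] `|` [set p].

Definition digitally_continuous (T U : Type) (N : T -> set T)
    (N' : U -> set U) (f : T -> U) : Prop :=
  forall x, f @` N x `<=` N' (f x).

Definition G_continuous n t (X : set (point n)) (op : X -> X -> X) : Prop :=
  digitally_continuous (@G_nbhd1 n t X) (@nbhd1 n t X)
    (fun p : X * X => op p.1 p.2).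

Definition group_laws (T : Type) (e : T) (inv : T -> T) (op : T -> T -> T)
    : Prop :=
  [/\ associative op, left_id e op, right_id e op,
      left_inverse e inv op & right_inverse e inv op].

Definition DT_group n t (X : set (point n)) (op : X -> X -> X) : Prop :=
  exists (e : X) (inv : X -> X),
    [/\ group_laws e inv op,
        G_continuous t op
      & digitally_continuous (@nbhd1 n t X) (@nbhd1 n t X) inv].

(* No multiplicative identity is required: a negative result for this notion
   of ring contains the one for rings with identity. *)
Definition ring_laws (T : Type) (add mul : T -> T -> T) : Prop :=
  [/\ exists (zero : T) (opp : T -> T), group_laws zero opp add,
      commutative add,
      associative mul,
      left_distributive mul add
    & right_distributive mul add].

Definition DT_ring n t (X : set (point n)) (add mul : X -> X -> X) : Prop :=
  [/\ DT_group t add, commutative add, ring_laws add mul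
    & G_continuous t mul].

Definition simple_closed_curve n t l (x : 'I_l -> point n) : Prop :=
  injective x /\
  forall i j : 'I_l,
    adjacent t (x i) (x j) <->
      (i = j + 1 %[mod l] \/ j = i + 1 %[mod l]).

(* x_i as an element of the digital image {x_0, ..., x_(l-1)} *)
Definition curve_point n l (x : 'I_l -> point n) (i : 'I_l) : range x :=
  SigSub (mem_set (imageT x i)).

(* Main.v *)
Require Import Defs.
From mathcomp Require Import all_boot all_order all_algebra.
From mathcomp Require Import boolp classical_sets.

Local Open Scope classical_set_scope.

(** Multiplication by [x_2] sends the adjacent points [x_0], [x_1] to [x_0],
    [x_2], which are distinct and not adjacent because [l >= 4]; hence the
    multiplication is not continuous. *)

(** By [G_continuous_mulr], right multiplication by a fixed element preserves the relation of being
    equal or adjacent. [curve_nbhd1P] turns that relation into congruences of indices, which 0 and 2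
    violate modulo [l]. *)

Lemma G_continuous_mulr (n t : nat) (X : set 'rV[int]_n) (op : X -> X -> X)
    (a b c : X) :
  G_continuous t op -> nbhd1 t a b -> nbhd1 t (op a c) (op b c).
Proof.
move=> op_cont ab; apply: (op_cont (a, c)); exists (b, c) => //.
(* [G_adjacent] relates distinct pairs only, so a coincidence must be placed in the centre of the
   neighbourhood. *)
have [->|ba_neq] := pselect ((b, c) = (a, c)); first by right.
by left; split=> //; left.
Qed.

Lemma curve_nbhd1P (n t l : nat) (x : 'I_l -> 'rV[int]_n) (i j : 'I_l) :
    simple_closed_curve t x ->
  nbhd1 t (curve_point x i) (curve_point x j) <->
  [\/ j = i + 1 %[mod l], i = j + 1 %[mod l] | j = i].
Proof.
move=> [x_inj x_adj]; split.
  by case=> [/x_adj[]|/(congr1 val)/x_inj];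
    [constructor 1|constructor 2|constructor 3].
by case=> [ji|ij|->];
  [left; apply/x_adj; left|left; apply/x_adj; right|right].
Qed.

Theorem mainTheorem2 (n t l : nat) (n_ge2 : 2 <= n)
    (t_bounds : 1 <= t <= n) (l_ge4 : 4 <= l)
    (x : 'I_l -> 'rV[int]_n) (x_curve : simple_closed_curve t x)
    (add mul : range x -> range x -> range x)
    (addE : forall i j m : 'I_l, m = i + j %[mod l] ->
       add (curve_point x i) (curve_point x j) = curve_point x m)
    (mulE : forall i j m : 'I_l, m = i * j %[mod l] ->
       mul (curve_point x i) (curve_point x j) = curve_point x m) :
  ~ DT_ring t add mul.
Proof.
case=> _ _ _ mul_cont.
have l_gt2 : 2 < l by exact: ltnW.
have l_gt1 : 1 < l by exact: ltnW.
have l_gt0 : 0 < l by exact: ltnW.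
pose i0 := Ordinal l_gt0; pose i1 := Ordinal l_gt1; pose i2 := Ordinal l_gt2.
have x01 : nbhd1 t (curve_point x i0) (curve_point x i1).
  by apply/(curve_nbhd1P _ _ _ _ _ _ x_curve); constructor 1.
have := G_continuous_mulr _ _ _ _ _ _ (curve_point x i2) mul_cont x01.
rewrite (mulE i0 i2 i0) // (mulE i1 i2 i2) //.
(* The three cases would force 2 = 1, 0 = 3 modulo [l], or 2 = 0; the second is where [l_ge4] is
   essential, as it fails to be absurd for [l] = 3. *)
by move=> /(curve_nbhd1P _ _ _ _ _ _ x_curve)[]; rewrite /= ?modn_small //.
Qed.
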